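(* Let $r\ge 1$ be an integer, $k$ a field, and $\mathbf d=(d_1,d_2)\in\mathbb Z^2$. Then (the Betti numbers $b^0,b^1$ of $\mathcal M_{k,r,\mathbf d}$ are finite and) $$\chi(\mathcal M_{k,r,\mathbf d})=d_1+d_2-(r-2).$$
   Context: **Category and sheaves.** Let $\mathcal C_{2V}$ be the category with objects $A_1,A_2,B_1,B_2,B_3$ whose non-identity morphisms are exactly one morphism for each of $A_1\to B_1$, $A_2\to B_2$, $A_1\to B_3$, $A_2\to B_3$. A sheaf of $k$-vector spaces $\mathcal F$ on $\mathcal C_{2V}$ is a contravariant functor to $k$-vector spaces: vector spaces $\mathcal F(P)$ for each object $P$ and a linear restriction map $\mathcal F(A_i,B_j):\mathcal F(B_j)\to\mathcal F(A_i)$ for each non-identity morphism $A_i\to B_j$. **Cohomology.** $H^0(\mathcal F)$ and $H^1(\mathcal F)$ are respectively the kernel and cokernel of $u:\bigoplus_{j=1}^3\mathcal F(B_j)\to\bigoplus_{i=1}^2\mathcal F(A_i)$, $u(m_1,m_2,m_3)=\bigl(\mathcal F(A_1,B_1)m_1-\mathcal F(A_1,B_3)m_3,\ \mathcal F(A_2,B_2)m_2-\mathcal F(A_2,B_3)m_3\bigr)$. Set $b^i(\mathcal F)=\dim_kH^i(\mathcal F)$, and when both are finite, $\chi(\mathcal F)=b^0(\mathcal F)-b^1(\mathcal F)$. **The sheaf $\mathcal M=\mathcal M_{k,r,\mathbf d}$.** Its values are $\mathcal M(B_1)=k[y_1]$, $\mathcal M(B_2)=k[y_2]$, $\mathcal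 M(B_3)=k[v,1/v]^{\oplus r}$, $\mathcal M(A_1)=k[x_1,1/x_1]$, $\mathcal M(A_2)=k[x_2,1/x_2]$ with $x_1,x_2,y_1,y_2,v$ indeterminates. Its restriction maps are: for $i=1,2$, $\mathcal M(A_i,B_i)(p(y_i))=x_i^{d_i}p(1/x_i)$; $\mathcal M(A_1,B_3)(q_1(v),\dots,q_r(v))=\sum_{j=1}^r x_1^{j-1}q_j(x_1^{r})$; $\mathcal M(A_2,B_3)(q_1(v),\dots,q_r(v))=\sum_{j=1}^r x_2^{j-1}q_j(x_2^{-r})$. *)

(* Defs.v *)
From HB Require Import structures.
From mathcomp Require Import all_boot all_order all_algebra.
From mathcomp Require Import boolp.
From mathcomp Require Import finmap monalg.

Set Implicit Arguments.
Unset Strict Implicit.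
Unset Printing Implicit Defensive.

Import GRing.Theory.
Local Open Scope ring_scope.

(* The ring of Laurent polynomials k[x, 1/x] is the algebra of the additive   *)
(* group of the integers; f@_n is the coefficient of x^n in f. Multinomials   *)
(* only provides the k-module structure of {malg k[int]}, because its monoids *)
(* are required to have no nontrivial units.                                  *)
Definition laurent (k : fieldType) : Type := {malg k[int]}.

HB.instance Definition _ (k : fieldType) :=
  GRing.Lmodule.copy (laurent k) {malg k[int]}.

Section LaurentRing.
Variable k : fieldType.
Implicit Types f g h : laurent k.

Definition laurent_monom (c : k) (n : int) : laurent k := mkmalgU n c.

Definition laurent_one : laurent k := laurent_monom 1 0.

Definition laurent_mul f g : laurent k :=
  \sum_(i <- msupp f) \sum_(j <- msupp g) laurent_monom (f@_i * g@_j) (i + j).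

Lemma laurent_monomD c1 c2 n :
  laurent_monom (c1 + c2) n = laurent_monom c1 n + laurent_monom c2 n.
Proof. exact: monalgUD. Qed.

Lemma laurent_monom0 n : laurent_monom 0 n = 0.
Proof. exact: monalgU0. Qed.

Lemma laurentE f : f = \sum_(n <- msupp f) laurent_monom f@_n n.
Proof. exact: monalgE. Qed.

Lemma laurent_mulw (D E : {fset int}) f g :
    (msupp f `<=` D)%fset -> (msupp g `<=` E)%fset ->
  laurent_mul f g =
    \sum_(i <- D) \sum_(j <- E) laurent_monom (f@_i * g@_j) (i + j).
Proof.
move=> fD gE; rewrite /laurent_mul (big_fset_incl _ fD) /=.
  apply: eq_bigr => i _; apply: big_fset_incl => // j _ /mcoeff_outdom ->.
  by rewrite mulr0 laurent_monom0.
move=> i _ /mcoeff_outdom fi0.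
by rewrite big1 // => j _; rewrite fi0 mul0r laurent_monom0.
Qed.

Lemma laurent_mulC : commutative laurent_mul.
Proof.
move=> f g; rewrite /laurent_mul exchange_big; apply: eq_bigr => j _.
by apply: eq_bigr => i _; rewrite mulrC addrC.
Qed.

Lemma laurent_mulDl : left_distributive laurent_mul +%R.
Proof.
move=> f g h.
rewrite (laurent_mulw (msuppD_le f g) (fsubset_refl (msupp h))).
rewrite (laurent_mulw (fsubsetUl (msupp f) (msupp g)) (fsubset_refl (msupp h))).
rewrite (laurent_mulw (fsubsetUr (msupp f) (msupp g)) (fsubset_refl (msupp h))).
rewrite -big_split /=; apply: eq_bigr => i _.
rewrite -big_split /=; apply: eq_bigr => j _.
by rewrite mcoeffD mulrDl laurent_monomD.
Qed.

Lemma laurent_mulDr : right_distributive laurent_mul +%R.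
Proof.
by move=> f g h; rewrite laurent_mulC laurent_mulDl !(laurent_mulC f).
Qed.

Lemma laurent_mul0l : left_zero 0 laurent_mul.
Proof. by move=> f; rewrite /laurent_mul msupp0 big_seq_fset0. Qed.

Lemma laurent_mul0r : right_zero 0 laurent_mul.
Proof. by move=> f; rewrite laurent_mulC laurent_mul0l. Qed.

Lemma laurent_mul_monom a b m n :
  laurent_mul (laurent_monom a m) (laurent_monom b n) =
    laurent_monom (a * b) (m + n).
Proof.
by rewrite (laurent_mulw msuppU_le msuppU_le) !big_seq_fset1 !mcoeffUU.
Qed.

Lemma laurent_mul_suml (I : Type) (s : seq I) (F : I -> laurent k) g :
  laurent_mul (\sum_(i <- s) F i) g = \sum_(i <- s) laurent_mul (F i) g.
Proof.
exact: (big_morph (laurent_mul^~ g) (fun _ _ => laurent_mulDl _ _ _)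
  (laurent_mul0l g)).
Qed.

Lemma laurent_mul_sumr (I : Type) (s : seq I) (F : I -> laurent k) g :
  laurent_mul g (\sum_(i <- s) F i) = \sum_(i <- s) laurent_mul g (F i).
Proof.
exact: (big_morph (laurent_mul g) (fun _ _ => laurent_mulDr _ _ _)
  (laurent_mul0r g)).
Qed.

Lemma laurent_mulA : associative laurent_mul.
Proof.
move=> f g h; rewrite [f]laurentE [g]laurentE [h]laurentE.
rewrite !laurent_mul_suml; apply: eq_bigr => l _.
rewrite [in LHS]laurent_mul_sumr.
rewrite [laurent_mul _ (\sum_(i <- msupp g) _) in RHS]laurent_mul_sumr.
rewrite laurent_mul_suml.
apply: eq_bigr => m _; rewrite !laurent_mul_sumr.
by apply: eq_bigr => n _; rewrite !laurent_mul_monom mulrA addrA.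
Qed.

Lemma laurent_mul1 : left_id laurent_one laurent_mul.
Proof.
move=> f; rewrite [f]laurentE laurent_mul_sumr; apply: eq_bigr => n _.
by rewrite laurent_mul_monom mul1r add0r.
Qed.

Lemma laurent_one_neq0 : laurent_one != 0.
Proof. by rewrite monalgU_eq0 oner_eq0. Qed.

HB.instance Definition _ := GRing.Zmodule_isComNzRing.Build (laurent k)
  laurent_mulA laurent_mulC laurent_mul1 laurent_mulDl laurent_one_neq0.

Lemma laurent_scale_monom a b n :
  a *: laurent_monom b n = laurent_monom (a * b) n.
Proof. by apply/malgP => m; rewrite mcoeffZ !mcoeffU mulrnAr. Qed.

Lemma laurent_scaleAl (a : k) f g : a *: (f * g) = (a *: f) * g.
Proof.
have aE h : a *: h = laurent_monom a 0 * h.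
  rewrite [h in LHS]laurentE [h in RHS]laurentE scaler_sumr mulr_sumr.
  apply: eq_bigr => n _; rewrite laurent_scale_monom.
  by rewrite [RHS]laurent_mul_monom add0r.
by rewrite !aE mulrA.
Qed.

HB.instance Definition _ :=
  GRing.Lmodule_isLalgebra.Build k (laurent k) laurent_scaleAl.
HB.instance Definition _ := GRing.Lalgebra_isComAlgebra.Build k (laurent k).

Definition laurent_unit : pred (laurent k) :=
  fun f => `[< exists g, g * f = 1 >].

Definition laurent_inv f : laurent k :=
  if pselect (exists g, g * f = 1) is left h then projT1 (cid h) else f.

Lemma laurent_mulVr : {in laurent_unit, left_inverse 1 laurent_inv *%R}.
Proof.
move=> f /asboolP fU; rewrite /laurent_inv; case: pselect => // h.
exact: (projT2 (cid h)).
Qed.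

Lemma laurent_unitP f g : g * f = 1 -> laurent_unit f.
Proof. by move=> gf1; apply/asboolP; exists g. Qed.

Lemma laurent_inv_out : {in [predC laurent_unit], laurent_inv =1 id}.
Proof.
move=> f /negP fNU; rewrite /laurent_inv; case: pselect => // h.
by case: fNU; apply/asboolP.
Qed.

HB.instance Definition _ := GRing.ComNzRing_hasMulInverse.Build (laurent k)
  laurent_mulVr laurent_unitP laurent_inv_out.

Definition laurentX : laurent k := laurent_monom 1 1.

Lemma laurentX_unit : laurentX \is a GRing.unit.
Proof.
apply: (@laurent_unitP laurentX (laurent_monom 1 (-1))).
by rewrite [LHS]laurent_mul_monom mulr1 addNr.
Qed.

Lemma laurentXE (n : int) : laurentX ^ n = laurent_monom 1 n.
Proof.
have XnE (m : nat) : laurentX ^+ m = laurent_monom 1 m%:Z.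
  elim: m => [|m IHm]; first by rewrite expr0.
  by rewrite exprS IHm [LHS]laurent_mul_monom mulr1 -[RHS]/(laurent_monom _ _).
case: n => m; first exact: XnE.
have Xm_unit : laurentX ^+ m.+1 \is a GRing.unit.
  by rewrite unitrX // laurentX_unit.
apply: (mulIr Xm_unit); rewrite -[_ ^ Negz m]/(laurentX ^- m.+1) mulVr //.
by rewrite XnE [RHS]laurent_mul_monom mulr1 NegzE addNr.
Qed.

Lemma laurent_evalw (A : unitAlgType k) (u : A) (D : {fset int}) f :
    (msupp f `<=` D)%fset ->
  \sum_(n <- msupp f) f@_n *: u ^ n = \sum_(n <- D) f@_n *: u ^ n.
Proof.
move=> fD; apply: big_fset_incl => // n _ /mcoeff_outdom ->.
by rewrite scale0r.
Qed.

(* the substitution x := u; only meaningful for a unit u *)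
Definition laurent_eval (A : unitAlgType k) (u : A) (q : laurent k) : A :=
  \sum_(n <- msupp q) q@_n *: u ^ n.

Lemma laurent_eval_is_linear (A : unitAlgType k) (u : A) :
  linear (laurent_eval u).
Proof.
move=> a f g; rewrite /laurent_eval.
have sub : (msupp (a *: f + g) `<=` msupp f `|` msupp g)%fset.
  by apply: fsubset_trans (msuppD_le _ _) _; apply: fsetSU; apply: msuppZ_le.
rewrite (laurent_evalw u sub) (laurent_evalw u (fsubsetUl (msupp f) (msupp g))).
rewrite (laurent_evalw u (fsubsetUr (msupp f) (msupp g))).
rewrite scaler_sumr -big_split /=; apply: eq_bigr => n _.
by rewrite mcoeffD mcoeffZ scalerDl scalerA.
Qed.

HB.instance Definition _ (A : unitAlgType k) (u : A) :=
  GRing.isLinear.Build k (laurent k) A *:%R (laurent_eval u)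
    (laurent_eval_is_linear u).

End LaurentRing.

Section Dimension.
Variable k : fieldType.

Definition is_basis (V : lmodType k) (n : nat) (b : 'I_n -> V) : Prop :=
  forall v, exists! c : {ffun 'I_n -> k}, v = \sum_(i < n) c i *: b i.

Definition has_dim (V : lmodType k) (n : nat) : Prop :=
  exists b : 'I_n -> V, is_basis b.

Definition finite_dim (V : lmodType k) : Prop := exists n, has_dim V n.

(* 0 when V is infinite-dimensional *)
Definition dim (V : lmodType k) : nat :=
  if pselect (finite_dim V) is left h then projT1 (cid h) else 0.

Lemma has_dim_leq (V : lmodType k) m n : has_dim V m -> has_dim V n -> (m <= n)%N.
Proof.
move=> [b bP] [c cP].
have /choice [f fE] i : exists a : {ffun 'I_n -> k}, b i = \sum_j a j *: c j.
  by have [a [aE _]] := cP (b i); exists a.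
pose M : 'M[k]_(m, n) := \matrix_(i, j) f i j.
suff /eqP <- : row_free M by rewrite rank_leq_col.
rewrite -kermx_eq0; apply/eqP/row_matrixP => l; rewrite row0.
set w := row l _.
have wM : w *m M = 0 by apply/sub_kermxP; exact: row_sub.
have [z [_ zU]] := bP 0.
have zw : z = [ffun i => w 0 i].
  apply: zU; under eq_bigr do rewrite ffunE fE scaler_sumr.
  rewrite exchange_big /= big1 // => j _.
  under eq_bigr do rewrite scalerA.
  rewrite -scaler_suml; suff -> : \sum_i w 0 i * f i j = 0 by rewrite scale0r.
  transitivity ((w *m M) 0 j); last by rewrite wM mxE.
  by rewrite [RHS]mxE; apply: eq_bigr => i _; rewrite [M i j]mxE.
have z0 : z = [ffun=> 0].
  by apply: zU; rewrite big1 // => i _; rewrite ffunE scale0r.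
apply/rowP => i; have /ffunP/(_ i) := zw.
by rewrite z0 !ffunE mxE => <-; rewrite mxE.
Qed.

Lemma dimE (V : lmodType k) n : has_dim V n -> dim V = n.
Proof.
move=> Vn; rewrite /dim; case: pselect => [h|[]]; last by exists n.
by case: (cid h) => m Vm /=; apply/eqP; rewrite eqn_leq !(@has_dim_leq V).
Qed.

End Dimension.

Section KernelCokernel.
Variables (k : fieldType) (U V : lmodType k) (f : {linear U -> V}).

Definition in_kernel : {pred U} := fun x => f x == 0.

Lemma in_kernel_submod_closed : submod_closed in_kernel.
Proof.
split=> [|a x y]; rewrite !unfold_in /in_kernel ?linear0 // linearP.
by move=> /eqP -> /eqP ->; rewrite scaler0 addr0.
Qed.

HB.instance Definition _ :=
  GRing.isSubmodClosed.Build k U in_kernel in_kernel_submod_closed.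

Record kernel : Type := Kernel { kernel_val :> U; _ : kernel_val \in in_kernel }.

HB.instance Definition _ := [isSub for kernel_val].
HB.instance Definition _ := [Choice of kernel by <:].
HB.instance Definition _ := [SubChoice_isSubLmodule of kernel by <:].

Definition in_image : {pred V} := fun y => `[< exists x, f x = y >].

Lemma in_image_submod_closed : submod_closed in_image.
Proof.
split=> [|a _ _ /asboolP [x <-] /asboolP [y <-]]; apply/asboolP.
  by exists 0; rewrite linear0.
by exists (a *: x + y); rewrite linearP.
Qed.

HB.instance Definition _ :=
  GRing.isSubmodClosed.Build k V in_image in_image_submod_closed.

Definition cokernel : Type := Quotient.quot in_image.

HB.instance Definition _ := GRing.Zmodule.on cokernel.
HB.instance Definition _ := EqQuotient.on cokernel.

Local Notation pi := (\pi_cokernel)%qT.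

Definition cokernel_scale (a : k) (x : cokernel) : cokernel := pi (a *: repr x).

Lemma cokernel_piP x y : (pi x = pi y) <-> exists z, f z = x - y.
Proof.
have -> : (pi x = pi y) <-> (x - y \in in_image).
  by rewrite Quotient.idealrBE; split=> [->|/eqP].
by split=> /asboolP.
Qed.

Lemma cokernel_scale_pi a x : cokernel_scale a (pi x) = pi (a *: x).
Proof.
apply/cokernel_piP.
have /cokernel_piP [z fz] : pi (repr (pi x)) = pi x by rewrite reprK.
by exists (a *: z); rewrite linearZ_LR fz scalerBr.
Qed.

Lemma cokernel_scaleA a b x :
  cokernel_scale a (cokernel_scale b x) = cokernel_scale (a * b) x.
Proof. by rewrite -[x]reprK !cokernel_scale_pi scalerA reprK. Qed.

Lemma cokernel_scale1 : left_id 1 cokernel_scale.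
Proof. by move=> x; rewrite -[x]reprK cokernel_scale_pi scale1r. Qed.

Lemma cokernel_scaleDr : right_distributive cokernel_scale +%R.
Proof.
move=> a x y; rewrite -[x]reprK -[y]reprK -[_ + _]raddfD.
by rewrite !cokernel_scale_pi scalerDr [LHS]raddfD.
Qed.

Lemma cokernel_scaleDl x :
  {morph cokernel_scale^~ x : a b / a + b >-> a + b}.
Proof.
move=> a b; rewrite -[x]reprK !cokernel_scale_pi scalerDl; exact: raddfD.
Qed.

HB.instance Definition _ := GRing.Zmodule_isLmodule.Build k cokernel
  cokernel_scaleA cokernel_scale1 cokernel_scaleDr cokernel_scaleDl.

End KernelCokernel.

(* The category C_2V. It has no composable pair of non-identity morphisms, so *)
(* a contravariant functor on it is just a family of restriction maps indexed *)
(* by arr.                                                                    *)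
Inductive obj : Type := A1 | A2 | B1 | B2 | B3.

Inductive arr : obj -> obj -> Type :=
| A1B1 : arr A1 B1
| A2B2 : arr A2 B2
| A1B3 : arr A1 B3
| A2B3 : arr A2 B3.

Record sheaf (k : fieldType) : Type := Sheaf {
  sections :> obj -> lmodType k;
  res : forall P Q : obj, arr P Q -> {linear sections Q -> sections P}
}.

Section Cohomology.
Variables (k : fieldType) (F : sheaf k).

Definition coboundary (m : F B1 * F B2 * F B3) : F A1 * F A2 :=
  let: (m1, m2, m3) := m in
  (res F A1B1 m1 - res F A1B3 m3, res F A2B2 m2 - res F A2B3 m3).

Lemma coboundary_is_linear : linear coboundary.
Proof.
move=> a [[m1 m2] m3] [[n1 n2] n3]; rewrite /coboundary /=; congr pair;
by rewrite linearP [X in _ - X]linearP opprD addrACA -scalerBr.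
Qed.

HB.instance Definition _ :=
  GRing.isLinear.Build k (F B1 * F B2 * F B3)%type (F A1 * F A2)%type *:%R
    coboundary coboundary_is_linear.

Definition H0 : lmodType k := kernel coboundary.
Definition H1 : lmodType k := cokernel coboundary.

Definition b0 : nat := dim H0.
Definition b1 : nat := dim H1.

(* only meaningful when H0 and H1 are finite-dimensional *)
Definition euler_char : int := b0%:Z - b1%:Z.

End Cohomology.

Section SheafM.
Variables (k : fieldType) (r : nat) (d : int * int).
Local Notation x := (laurentX k).

Definition M_sections (P : obj) : lmodType k :=
  match P with
  | A1 | A2 => laurent k
  | B1 | B2 => {poly k}
  | B3 => {ffun 'I_r -> laurent k}
  end.

(* p(y) |-> x^e p(1/x) *)
Definition M_res_poly (e : int) (p : {poly k}) : laurent k :=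
  x ^ e * horner_alg x^-1 p.

(* (q_1(v), ..., q_r(v)) |-> \sum_(1 <= j <= r) x^(j-1) q_j(x^e) *)
Definition M_res_laurent (e : int) (q : {ffun 'I_r -> laurent k}) : laurent k :=
  \sum_(j < r) x ^+ j * laurent_eval (x ^ e) (q j).

Lemma M_res_poly_is_linear e : linear (M_res_poly e).
Proof. by move=> a p q; rewrite /M_res_poly linearP /= mulr_algl mulrDr scalerAr. Qed.

HB.instance Definition _ e :=
  GRing.isLinear.Build k {poly k} (laurent k) *:%R (M_res_poly e)
    (M_res_poly_is_linear e).

Lemma M_res_laurent_is_linear e : linear (M_res_laurent e).
Proof.
move=> a p q; rewrite /M_res_laurent scaler_sumr -big_split /=.
by apply: eq_bigr => j _; rewrite !ffunE linearP mulrDr scalerAr.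
Qed.

HB.instance Definition _ e :=
  GRing.isLinear.Build k {ffun 'I_r -> laurent k} (laurent k) *:%R
    (M_res_laurent e) (M_res_laurent_is_linear e).

Definition M_res (P Q : obj) (a : arr P Q) :
    {linear M_sections Q -> M_sections P} :=
  match a in arr P Q return {linear M_sections Q -> M_sections P} with
  | A1B1 => M_res_poly d.1
  | A2B2 => M_res_poly d.2
  | A1B3 => M_res_laurent r%:Z
  | A2B3 => M_res_laurent (- r%:Z)
  end.

Definition sheafM : sheaf k := @Sheaf k M_sections M_res.

End SheafM.

(* Main.v *)
(* All the maps are monomial. Restriction from B3 to A1 sends v^m in the j-th
   component (0 <= j < r) to x1^(j + r m), a bijection between monomial bases by
   Euclidean division, and similarly to x2^(j - r m) for A2. Restriction from
   B_i reaches exactly the powers x_i^n with n <= d_i. Hence H^0 has a basis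
   indexed by the pairs (j, m) with j + r m <= d1 and j - r m <= d2, and H^1 one
   indexed by the pairs violating both inequalities. With
   P_j = floor((d1 - j) / r) and Q_j = floor((d2 - j) / r), row j contributes
   max(0, P_j + Q_j + 1) to the first set and max(0, - P_j - Q_j - 1) to the
   second, so the Euler characteristic is the sum over j of P_j + Q_j + 1. *)

Require Import Defs.
From mathcomp Require Import all_boot all_order all_algebra.
From mathcomp Require Import finmap monalg zify.

Set Implicit Arguments.
Unset Strict Implicit.
Unset Printing Implicit Defensive.

Import Order.TTheory GRing.Theory Num.Theory.
Local Open Scope ring_scope.

(** * Dimensions from biorthogonal families *)

Section DualBasis.
Variable k : fieldType.

(** Biorthogonality forces the coordinates of [v] to be the [phi i v]; [v] minus the resulting
    expansion is killed by every [phi i], hence zero. *)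
Lemma has_dim_dual (V : lmodType k) (I : finType) (b : I -> V)
    (phi : I -> V -> k) :
    (forall i, scalar (phi i)) ->
    (forall i j, phi i (b j) = (i == j)%:R) ->
    (forall v, (forall i, phi i v = 0) -> v = 0) ->
  has_dim V #|I|.
Proof.
move=> phiL phib phi_inj.
have phi0 i : phi i 0 = 0.
  by rewrite -[X in phi i X](addNr 0) -scaleN1r phiL mulN1r addNr.
have phi_sum i (c : 'I_#|I| -> k) :
    phi (enum_val i) (\sum_j c j *: b (enum_val j)) = c i.
  transitivity (\sum_j c j * (i == j)%:R).
    apply: (big_ind2 (fun v a => phi (enum_val i) v = a)) => //.
      by move=> v a w a' va wa; rewrite -va -wa -[v]scale1r phiL mul1r scale1r.
    move=> j _.
    by rewrite -[_ *: _]addr0 phiL phib phi0 addr0 (inj_eq enum_val_inj).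
  rewrite (bigD1 i) //= eqxx mulr1 big1 ?addr0 // => j ji.
  by rewrite eq_sym (negPf ji) mulr0.
exists (fun i => b (enum_val i)) => v.
exists [ffun i => phi (enum_val i) v]; split=> [|c ->]; last first.
  by apply/ffunP => i; rewrite ffunE phi_sum.
apply/eqP; rewrite eq_sym -subr_eq0 -scaleN1r addrC; apply/eqP.
apply: phi_inj => i.
by rewrite phiL -[i]enum_rankK phi_sum ffunE mulN1r addNr.
Qed.

Variables (U V : lmodType k) (f : {linear U -> V}) (I : finType).

Lemma kernel_has_dim (b : I -> U) (phi : I -> U -> k) :
    (forall i, scalar (phi i)) ->
    (forall i, f (b i) = 0) ->
    (forall i j, phi i (b j) = (i == j)%:R) ->
    (forall x, f x = 0 -> (forall i, phi i x = 0) -> x = 0) ->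
  has_dim (kernel f) #|I|.
Proof.
move=> phiL fb phib phi_inj.
have bK i : b i \in in_kernel f by rewrite unfold_in /in_kernel fb.
apply: (@has_dim_dual _ I (fun i => Kernel (bK i)) (fun i x => phi i (val x))).
- by move=> i a x y; rewrite linearP phiL.
- by move=> i j; rewrite phib.
move=> [x xK] phix; apply: val_inj; rewrite linear0 /=.
by apply: phi_inj => //; apply/eqP.
Qed.

(** Functionals killing the image descend to the quotient, and they separate its points as soon as
    their common zeros lie in the image. *)
Lemma cokernel_has_dim (b : I -> V) (phi : I -> V -> k) :
    (forall i, scalar (phi i)) ->
    (forall i x, phi i (f x) = 0) ->
    (forall i j, phi i (b j) = (i == j)%:R) ->
    (forall y, (forall i, phi i y = 0) -> exists x, f x = y) ->
  has_dim (cokernel f) #|I|.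
Proof.
move=> phiL phif phib im.
pose pi : V -> cokernel f := \pi_(cokernel f)%qT.
(* The chosen representative differs from [y] by an element of the image. *)
have phi_pi i y : phi i (repr (pi y)) = phi i y.
  have /cokernel_piP [z fz] : pi (repr (pi y)) = pi y by rewrite /pi reprK.
  by rewrite -[repr _](subrK y) -fz -[f z]scale1r phiL phif mulr0 add0r.
have piP a x y : a *: pi x + pi y = pi (a *: x + y).
  have -> : a *: pi x = pi (a *: x) by exact: cokernel_scale_pi.
  by rewrite [RHS]raddfD.
apply: (@has_dim_dual _ I (fun i => pi (b i)) (fun i x => phi i (repr x))).
- move=> i a x y; rewrite -[x]reprK -[y]reprK.
  by rewrite [X in repr X]piP !phi_pi phiL.
- by move=> i j; rewrite phi_pi phib.
move=> v phiv; have [z fz] := im _ phiv.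
rewrite -[v]reprK -[RHS](raddf0 pi); apply/cokernel_piP.
by exists z; rewrite subr0.
Qed.

End DualBasis.

(** * Coefficients of the restriction maps *)

Section Coefficients.
Variable k : fieldType.
Local Notation x := (laurentX k).

Lemma mcoeff_XzM (n : int) (f : laurent k) (m : int) :
  (x ^ n * f)@_m = f@_(m - n).
Proof.
rewrite laurentXE [f]laurentE mulr_sumr !raddf_sum /=; apply: eq_bigr => i _.
rewrite [_ * _]laurent_mul_monom mul1r !mcoeffU.
by congr (_ *+ _); congr nat_of_bool; lia.
Qed.

Lemma mcoeff_M_res_poly e (p : {poly k}) (n : int) :
  (M_res_poly e p)@_n = if n <= e then p`_`|e - n| else 0.
Proof.
have resXn i : M_res_poly e 'X^i = laurent_monom 1 (e - i%:Z) :> laurent k.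
  rewrite /M_res_poly rmorphXn /= horner_algX.
  rewrite -[x^-1 ^+ i]/(x^-1 ^ i) exprz_inv -exprzDr.
    by rewrite laurentXE.
  exact: laurentX_unit.
rewrite -[p in LHS]coefK poly_def linear_sum raddf_sum /=.
under eq_bigr do rewrite linearZ /= resXn laurent_scale_monom mulr1 mcoeffU.
have [ne|ne] := ifPn; last first.
  by rewrite big1 // => i _; case: eqP => // ?; lia.
have [lt|ge] := ltnP `|e - n| (size p).
  rewrite (bigD1 (Ordinal lt)) //= big1 => [|i /eqP/val_eqP /= ni].
    by rewrite addr0; case: eqP => // ?; lia.
  by case: eqP => // ?; lia.
rewrite nth_default // big1 // => i _; case: eqP => // ?.
by have := leq_trans (ltn_ord i) ge; lia.
Qed.

Lemma mcoeff_laurent_eval e (f : laurent k) (n : int) : e != 0 ->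
  (laurent_eval (x ^ e) f)@_n = if (e %| n)%Z then f@_(n %/ e)%Z else 0.
Proof.
move=> e0; rewrite raddf_sum /=.
have xE i : (f@_i *: (x ^ e) ^ i)@_n = if e * i == n then f@_i else 0.
  rewrite exprz_exp laurentXE laurent_scale_monom mulr1 mcoeffU.
  by case: eqP.
under eq_bigr do rewrite xE.
have [/dvdzP [m ->]|eNn] := ifPn; last first.
  rewrite big1 // => i _; case: eqP => // en; case/negP: eNn.
  by rewrite -en dvdz_mulr.
rewrite mulzK // [in RHS](laurentE f) raddf_sum /=; apply: eq_bigr => i _.
by rewrite mcoeffU mulrC (inj_eq (mulIf e0)); case: eqP.
Qed.

(** Both indices are the remainder modulo [r]. Assuming only [|e| = r] serves the exponents [r] and
    [- r] at once. *)
Lemma ord_residue_inj r (e : int) (i j : 'I_r) (m n : int) : `|e| = r%:Z ->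
  i%:Z + e * m = j%:Z + e * n -> i = j.
Proof.
move=> er ijE; apply/val_inj/eqP; rewrite -eqz_nat; apply/eqP.
have modE (l : 'I_r) (z : int) : l%:Z = ((l%:Z + e * z)%R %% e)%Z.
  rewrite mulrC addrC modzMDl -modz_abs abszE er modz_small //.
  exact: ltn_ord.
by rewrite [LHS](modE i m) ijE -modE.
Qed.

(** The summands of [M_res_laurent] live in distinct residue classes modulo [r], so only the [j]-th
    one contributes. *)
Lemma mcoeff_M_res_laurent r e (q : {ffun 'I_r -> laurent k}) (j : 'I_r)
    (m : int) :
  `|e| = r%:Z -> (M_res_laurent e q)@_(j%:Z + e * m) = (q j)@_m.
Proof.
move=> er; have e0 : e != 0 by have := ltn_ord j; lia.
have xE (i : 'I_r) : (x ^+ i * laurent_eval (x ^ e) (q i))@_(j%:Z + e * m) =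
    if (e %| j%:Z - i%:Z + e * m)%Z then (q i)@_((j%:Z - i%:Z + e * m) %/ e)%Z
    else 0.
  rewrite -[x ^+ i]/(x ^ i) mcoeff_XzM mcoeff_laurent_eval //.
  by rewrite addrAC.
rewrite raddf_sum /=; under eq_bigr do rewrite xE.
rewrite (bigD1 j) //= big1 => [|i ij].
  by rewrite subrr add0r dvdz_mulr // mulKz // addr0.
case: ifP => // /dvdzP [z jiE].
case/eqP: ij; apply: (@ord_residue_inj r e _ _ z m) => //; lia.
Qed.

Lemma ord_residue r (e n : int) : (0 < r)%N -> `|e| = r%:Z ->
  exists (j : 'I_r) (m : int), n = j%:Z + e * m.
Proof.
move=> r0 er; have e0 : e != 0 by lia.
have := modz_ge0 n e0; have := ltz_mod n e0; have := divz_eq n e.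
case: (n %% e)%Z => // j nE jr _; rewrite er in jr.
by exists (Ordinal (jr : (j < r)%N)), (n %/ e)%Z; rewrite mulrC addrC.
Qed.

Lemma M_res_poly_inj e : injective (@M_res_poly k e).
Proof.
have coefE (p : {poly k}) i : p`_i = (M_res_poly e p)@_(e - i%:Z)%R.
  rewrite mcoeff_M_res_poly ifT; last lia.
  by congr nth; lia.
by move=> p p' pp'; apply/polyP => i; rewrite (coefE p) (coefE p') pp'.
Qed.

Definition delta_ffun r (j : 'I_r) (f : laurent k) : {ffun 'I_r -> laurent k} :=
  [ffun i => if i == j then f else 0].

Lemma M_res_laurent_delta r e (j : 'I_r) c (m : int) : `|e| = r%:Z ->
  M_res_laurent e (delta_ffun j (laurent_monom c m)) =
    laurent_monom c (j%:Z + e * m).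
Proof.
move=> er; have e0 : e != 0 by have := ltn_ord j; lia.
apply/malgP => n; have [||i [l ->]] := @ord_residue r e n => //.
  by have := ltn_ord j; lia.
rewrite mcoeff_M_res_laurent // ffunE; have [->|ij] := eqVneq i j.
  by rewrite !mcoeffU (inj_eq (addrI _)) (inj_eq (mulfI e0)).
rewrite mcoeff0 mcoeffU; case: eqP => // /(ord_residue_inj er) ji.
by rewrite ji eqxx in ij.
Qed.

Lemma M_res_polyZXn e c (n : int) : n <= e ->
  M_res_poly e (c *: 'X^`|e - n|) = laurent_monom c n :> laurent k.
Proof.
move=> ne; apply/malgP => m; rewrite mcoeff_M_res_poly coefZ coefXn mcoeffU.
case: ifP => me; last by case: eqP => // ?; lia.
by rewrite mulr_natr; congr (_ *+ _); congr nat_of_bool; lia.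
Qed.

End Coefficients.

(** * Counting lattice points row by row *)

Section Strips.
Variable r : nat.
Implicit Types lo hi : 'I_r -> int.

(** Truncation at 0 empties the rows whose bounds are crossed, so swapping [lo] and [hi] gives the
    complementary strip needed for H^1. *)
Definition width lo hi (j : 'I_r) : nat := absz (Num.max 0 (hi j - lo j)).

(* The points [(j, m)] with [lo j <= m < hi j]. *)
Definition strip lo hi : finType := {j : 'I_r & 'I_(width lo hi j)}.

Definition row lo hi (i : strip lo hi) : 'I_r := tag i.

Definition height lo hi (i : strip lo hi) : int :=
  lo (tag i) + (nat_of_ord (tagged i))%:Z.

Lemma height_bounds lo hi (i : strip lo hi) :
  lo (row i) <= height i < hi (row i).
Proof.
case: i => j t; rewrite /height /row /=; move: (ltn_ord t); rewrite /width.
by move: (nat_of_ord t) => n; move: (lo j) (hi j) => a b; lia.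
Qed.

Lemma strip_surj lo hi (j : 'I_r) (m : int) : lo j <= m < hi j ->
  exists i : strip lo hi, row i = j /\ height i = m.
Proof.
move=> mP; have lt : (absz (m - lo j)%R < width lo hi j)%N.
  by rewrite /width; move: (lo j) (hi j) mP => a b; lia.
exists (Tagged (fun j => 'I_(width lo hi j)) (Ordinal lt)).
split=> //; rewrite /height /row /=.
by move: (lo j) (hi j) mP => a b; lia.
Qed.

Lemma strip_eqE lo hi (i i' : strip lo hi) :
  (i == i') = (row i == row i') && (height i == height i').
Proof.
apply/eqP/andP => [->|[]]; first by rewrite !eqxx.
case: i i' => j t [j' t']; rewrite /height /row /= => /eqP jj'; subst j'.
by move=> /eqP/addrI [] /val_inj ->.
Qed.

(** In each row this is max(0, t) - max(0, -t) = t with t = [hi j - lo j]. *)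
Lemma card_stripB lo hi :
  #|strip lo hi|%:Z - #|strip hi lo|%:Z = \sum_j (hi j - lo j).
Proof.
have cardE a b : #|strip a b| = (\sum_j width a b j)%N.
  rewrite card_tagged sumnE big_map big_enum /=.
  by apply: eq_bigr => j _; rewrite card_ord.
rewrite !cardE -!natz !natr_sum -sumrB.
apply: eq_bigr => j _; rewrite !natz /width.
by move: (lo j) (hi j) => a b; lia.
Qed.

End Strips.

(** Write d = q r + t with 0 <= t < r. The quotient is q for j <= t and q - 1 for the r - 1 - t
    indices j > t, so the sum is q r - (r - 1 - t). *)
Lemma sum_divzB r (d : int) : (0 < r)%N ->
  \sum_(j < r) ((d - j%:Z)%R %/ r%:Z)%Z = d - r%:Z + 1.
Proof.
move=> r0; have rz : r%:Z != 0 by lia.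
have := divz_eq d r%:Z; have := modz_ge0 d rz; have := ltz_mod d rz.
move: (d %/ r%:Z)%Z; case: (d %% r%:Z)%Z => // t q tr _ dE.
have {}tr : (t < r)%N by lia.
have divE (j : 'I_r) : ((d - j%:Z)%R %/ r%:Z)%Z = q - (t < j)%N%:Z.
  have := ltn_ord j => jr; case: ltnP => tj.
    have -> : d - j%:Z = (q - 1) * r%:Z + (r + t - j)%N%:Z.
      by rewrite mulrBl dE; lia.
    by rewrite divzMDl // divz_nat divn_small; lia.
  have -> : d - j%:Z = q * r%:Z + (t - j)%N%:Z by rewrite dE; lia.
  by rewrite divzMDl // divz_nat divn_small; lia.
under eq_bigr do rewrite divE.
rewrite sumrB sumr_const card_ord -mulr_natr natz.
have -> : \sum_(j < r) (t < j)%N%:Z = (r - t.+1)%:Z.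
  under eq_bigr do rewrite -natz; rewrite -natr_sum natz; congr Posz.
  rewrite -(big_mkord xpredT (fun j => nat_of_bool (t < j)%N)).
  rewrite (@big_cat_nat _ _ _ t.+1) //=.
  rewrite big_nat big1 ?add0n => [|j]; last by lia.
  rewrite big_nat (eq_bigr (fun=> 1%N)) => [|j]; last by lia.
  by rewrite -big_nat sum_nat_const_nat muln1.
by rewrite dE; lia.
Qed.

(* Matching one restriction map against the other would otherwise unfold both
   and nearly diverge. *)
Local Opaque M_res_poly M_res_laurent.

(** * Explicit bases of H^0 and H^1 *)

Section Betti.
Variables (k : fieldType) (r : nat) (d : int * int).
Hypothesis r_gt0 : (0 < r)%N.
Local Notation F := (sheafM k r d).

Definition row_start (j : 'I_r) : int := - ((d.2 - j%:Z)%R %/ r%:Z)%Z.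
Definition row_stop (j : 'I_r) : int := ((d.1 - j%:Z)%R %/ r%:Z)%Z + 1.

(* [v^m] in the component [j] of B3 restricts to [x1^(j + r m)] and
   [x2^(j - r m)]; the former lies in the image of B1 iff [m < row_stop j], the
   latter in the image of B2 iff [row_start j <= m]. *)
Lemma row_stopP (j : 'I_r) (m : int) :
  (m < row_stop j) = (j%:Z + r%:Z * m <= d.1).
Proof.
rewrite /row_stop ltzD1 lez_divRL; last lia.
by rewrite mulrC lerBrDl.
Qed.

Lemma row_startP (j : 'I_r) (m : int) :
  (row_start j <= m) = (j%:Z + - r%:Z * m <= d.2).
Proof.
rewrite /row_start lerNl lez_divRL; last lia.
have -> : - m * r%:Z = - r%:Z * m by lia.
by rewrite lerBrDl.
Qed.

Lemma abs_r : `|r%:Z| = r%:Z.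
Proof. lia. Qed.

Lemma absN_r : `|- r%:Z| = r%:Z.
Proof. lia. Qed.

(** Convertible to [coboundary] on [F], but with the restriction maps of [F] already resolved, so
    that the coefficient lemmas can rewrite in it. *)
Definition M_coboundary (p1 p2 : {poly k}) (q : {ffun 'I_r -> laurent k}) :
    laurent k * laurent k :=
  (M_res_poly d.1 p1 - M_res_laurent r%:Z q,
   M_res_poly d.2 p2 - M_res_laurent (- r%:Z) q).

Lemma M_res_poly0 e : M_res_poly e 0 = 0 :> laurent k.
Proof. exact: linear0. Qed.

Lemma M_res_laurent0 e : M_res_laurent e (0 : {ffun 'I_r -> laurent k}) = 0.
Proof. exact: (raddf0 (M_res_laurent e)). Qed.

Lemma M_res_laurentN e (q : {ffun 'I_r -> laurent k}) :
  M_res_laurent e (- q) = - M_res_laurent e q.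
Proof. exact: (raddfN (M_res_laurent e)). Qed.

Lemma M_res_poly_out e (p : {poly k}) (n : int) :
  ~~ (n <= e) -> (M_res_poly e p)@_n = 0.
Proof. by rewrite mcoeff_M_res_poly => /negPf ->. Qed.

(** A cocycle is determined by its B3 component, whose coefficients can be nonzero only where both
    restrictions are reached by B1 and B2. *)
Lemma H0_sheafM_has_dim : has_dim (H0 F) #|strip row_start row_stop|.
Proof.
(* A monomial on B3 with its preimages on B1 and B2; the scalar 1 matches the form of
   [M_res_polyZXn]. *)
pose b (i : strip row_start row_stop) : F B1 * F B2 * F B3 :=
  (1 *: 'X^(absz (d.1 - ((row i)%:Z + r%:Z * height i))%R),
   1 *: 'X^(absz (d.2 - ((row i)%:Z + - r%:Z * height i))%R),
   delta_ffun (row i) (laurent_monom 1 (height i))).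
pose phi (i : strip row_start row_stop) (y : F B1 * F B2 * F B3) : k :=
  ((y.2 : {ffun 'I_r -> laurent k}) (row i))@_(height i).
apply: (@kernel_has_dim _ _ _ _ _ b phi).
- by move=> i a y z; rewrite /phi /= !ffunE mcoeffD mcoeffZ.
- move=> i; have /andP[lo hi] := height_bounds i.
  rewrite row_startP in lo; rewrite row_stopP in hi.
  rewrite /b -[LHS]/(M_coboundary _ _ _) /M_coboundary.
  rewrite !M_res_polyZXn // (M_res_laurent_delta _ _ _ abs_r).
  by rewrite (M_res_laurent_delta _ _ _ absN_r) !subrr.
- move=> i j; rewrite /phi /= ffunE strip_eqE.
  case: eqP => _ /=; last by rewrite mcoeff0.
  by rewrite mcoeffU eq_sym.
move=> [[p1 p2] q] uq0 phi0.
have [p1E p2E] : M_res_poly d.1 p1 = M_res_laurent r%:Z q /\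
    M_res_poly d.2 p2 = M_res_laurent (- r%:Z) q.
  have uE : M_coboundary p1 p2 q = 0 by exact: uq0.
  by split; apply: subr0_eq; [exact: (congr1 fst uE) | exact: (congr1 snd uE)].
have q0 : q = 0.
  apply/ffunP => j; rewrite ffunE; apply/malgP => m; rewrite mcoeff0.
  (* Above the strip the A1 equation kills the coefficient, below it the A2 equation does; inside,
     [phi0] applies. *)
  have [hi|hi] := boolP (m < row_stop j); last first.
    rewrite -(mcoeff_M_res_laurent _ _ _ abs_r) -p1E M_res_poly_out //.
    by rewrite -row_stopP.
  have [lo|lo] := boolP (row_start j <= m); last first.
    rewrite -(mcoeff_M_res_laurent _ _ _ absN_r) -p2E M_res_poly_out //.
    by rewrite -row_startP.
  have mP : row_start j <= m < row_stop j by rewrite lo.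
  by have [i [<- <-]] := strip_surj mP; exact: phi0.
rewrite {}q0 in p1E p2E *.
have -> : p1 = 0 by apply: (@M_res_poly_inj k d.1); rewrite p1E !raddf0.
by have -> : p2 = 0 by apply: (@M_res_poly_inj k d.2); rewrite p2E !raddf0.
Qed.

Lemma M_res_laurent_surj (f : laurent k) :
  exists q, @M_res_laurent k r r%:Z q = f.
Proof.
rewrite [f]laurentE; apply:
  (big_ind (fun g => exists q, @M_res_laurent k r r%:Z q = g)).
- by exists 0; rewrite raddf0.
- by move=> _ _ [p <-] [q <-]; exists (p + q); rewrite raddfD.
move=> n _; have [j [m ->]] := ord_residue n r_gt0 abs_r.
by exists (delta_ffun j (laurent_monom f@_(j%:Z + r%:Z * m) m));
  rewrite (M_res_laurent_delta _ _ _ abs_r).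
Qed.

(** At a point of this strip neither exponent is reached from B1 or B2, while B3 contributes the
    same coefficient on both sides; the difference [phi] therefore kills the image. *)
Lemma H1_sheafM_has_dim : has_dim (H1 F) #|strip row_stop row_start|.
Proof.
pose b (i : strip row_stop row_start) : F A1 * F A2 :=
  (laurent_monom 1 ((row i)%:Z + r%:Z * height i), 0).
pose phi (i : strip row_stop row_start) (y : F A1 * F A2) : k :=
  (y.1 : laurent k)@_((row i)%:Z + r%:Z * height i) -
  (y.2 : laurent k)@_((row i)%:Z + - r%:Z * height i).
have out (i : strip row_stop row_start) :
    ~~ ((row i)%:Z + r%:Z * height i <= d.1) /\
    ~~ ((row i)%:Z + - r%:Z * height i <= d.2).
  by rewrite -row_stopP -row_startP -leNgt -ltNge; apply/andP/height_bounds.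
apply: (@cokernel_has_dim _ _ _ _ _ b phi).
- move=> i a y z; rewrite /phi /= !mcoeffD !mcoeffZ mulrBr.
  by rewrite opprD addrACA.
- move=> i [[p1 p2] q]; have [out1 out2] := out i.
  rewrite -[LHS]/(phi i (M_coboundary p1 p2 q)) /phi /= !mcoeffB.
  rewrite !M_res_poly_out //.
  rewrite (mcoeff_M_res_laurent _ _ _ abs_r).
  by rewrite (mcoeff_M_res_laurent _ _ _ absN_r) subrr.
- move=> i j; rewrite /phi /= mcoeff0 subr0 mcoeffU strip_eqE.
  congr (nat_of_bool _)%:R; apply/eqP/andP => [ijE|[/eqP -> /eqP ->] //].
  have tE := ord_residue_inj abs_r ijE; split; apply/eqP => //.
  by move: ijE; rewrite tE => /addrI /mulfI ->; lia.
move=> [a1 a2] phi0.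
(* Lifting [a1] to B3 clears the A1 component. *)
have [q qE] := M_res_laurent_surj a1.
pose Im (y : laurent k * laurent k) := exists z, coboundary (F := F) z = y.
have ImD y z : Im y -> Im z -> Im (y + z).
  by move=> [u <-] [v <-]; exists (u + v); rewrite raddfD.
pose c := a2 - M_res_laurent (- r%:Z) q.
have uq : M_coboundary 0 0 (- q) = (a1, M_res_laurent (- r%:Z) q).
  rewrite -qE /M_coboundary !M_res_poly0 !M_res_laurentN.
  by congr pair; rewrite sub0r opprK.
have -> : (a1, a2) = M_coboundary 0 0 (- q) + (0, c).
  by rewrite uq; congr pair; rewrite /= ?addr0 // /c addrC subrK.
(* Modulo the image, every class is represented in the A2 factor. *)
apply: (ImD); first by exists (0, 0, - q).
have -> : (0, c) =
    \sum_(n <- msupp c) (0, laurent_monom c@_n n) :> laurent k * laurent k.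
  apply/eqP; rewrite -pair_eqE /= !raddf_sum /= big1 // eqxx /=.
  by rewrite -laurentE.
apply: (big_ind Im _ ImD) => [|n _]; first by exists 0; rewrite raddf0.
have [j [m ->]] := ord_residue n r_gt0 absN_r.
set a := c@_(_).
(* Here the monomial comes directly from B2. *)
have [lo|lo] := boolP (row_start j <= m).
  exists (0, a *: 'X^(absz (d.2 - (j%:Z + - r%:Z * m))%R), 0).
  rewrite -[LHS]/(M_coboundary _ _ _) /M_coboundary M_res_poly0.
  rewrite !M_res_laurent0 !subr0 M_res_polyZXn //.
  by rewrite -row_startP.
have [hi|hi] := boolP (m < row_stop j).
  (* The B3 monomial with coefficient [- a] gives [a] on A2 by the sign in the coboundary; the B1
     term cancels its A1 restriction. *)
  exists ((- a) *: 'X^(absz (d.1 - (j%:Z + r%:Z * m))%R), 0,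
     delta_ffun j (laurent_monom (- a) m)).
  rewrite -[LHS]/(M_coboundary _ _ _) /M_coboundary M_res_poly0.
  rewrite M_res_polyZXn; last first.
    by rewrite -row_stopP.
  rewrite (M_res_laurent_delta _ _ _ abs_r).
  rewrite (M_res_laurent_delta _ _ _ absN_r) subrr sub0r.
  by rewrite /laurent_monom monalgUN opprK.
(* Otherwise (j, m) is a point of the strip, and there [phi0] says exactly that this coefficient of
   [c] vanishes. *)
suff -> : a = 0 by exists 0; rewrite raddf0 laurent_monom0.
have mP : row_stop j <= m < row_start j by rewrite leNgt hi ltNge.
have [i [ij im]] := strip_surj mP.
have /eqP := phi0 i; rewrite /phi ij im subr_eq0 => /eqP /= a12.
rewrite /a /c mcoeffB -a12 -qE (mcoeff_M_res_laurent _ _ _ abs_r).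
by rewrite (mcoeff_M_res_laurent _ _ _ absN_r) subrr.
Qed.

End Betti.

Theorem theorem8p2 (k : fieldType) (r : nat) (d : int * int) (hr : (1 <= r)%N) :
  [/\ finite_dim (H0 (sheafM k r d)),
      finite_dim (H1 (sheafM k r d)) &
      euler_char (sheafM k r d) = d.1 + d.2 - (r%:Z - 2)].
Proof.
have h0 := H0_sheafM_has_dim k d hr; have h1 := H1_sheafM_has_dim k d hr.
split; [by eexists; exact: h0 | by eexists; exact: h1 |].
rewrite /euler_char /b0 /b1 (dimE h0) (dimE h1) card_stripB.
under eq_bigr do rewrite /row_stop /row_start opprK.
(* The three sums are d1 - r + 1, r and d2 - r + 1. *)
rewrite !big_split /= !sum_divzB // sumr_const card_ord natz.
lia.
Qed.
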